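(* Let $H$ be a finite poset whose Hasse diagram is a tree and whose height is $k\geq 2$. Let $\epsilon$ be a (small) positive real. Then for every positive integer $n$ sufficiently large depending on $H$ and $\epsilon$, every family $\mathcal{F}\subseteq \widetilde{\mathbb{B}}_n$ with $|\mathcal{F}|\geq (k-1+\epsilon)\binom{n}{\lfloor n/2\rfloor}$ contains $H$ as an induced subposet.
   Context: $[n]=\{1,\dots,n\}$ and $\mathbb{B}_n=(2^{[n]},\subseteq)$. Define $\widetilde{\mathbb{B}}_n=\{v\subseteq [n]: |v|\in [\frac n2-2\sqrt{n\ln n},\ \frac n2+2\sqrt{n\ln n}]\}$. Families of subsets are regarded as posets under $\subseteq$. The height of a poset is the largest cardinality of a chain in it. A poset $G=(S,\leq)$ contains $H=(S',\leq')$ as an induced subposet if there is an injection $f:S'\to S$ such that for all $u,v\in S'$, $u\leq' v$ if and only if $f(u)\leq f(v)$. *)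

(* Defs.v *)
From HB Require Import structures.
From mathcomp Require Import all_boot all_order all_algebra.
From mathcomp Require Import reals exp.

Set Implicit Arguments.
Unset Strict Implicit.
Unset Printing Implicit Defensive.

Import Order.TTheory GRing.Theory Num.Theory.

Section FinitePoset.
Context {disp : Order.disp_t} {T : finPOrderType disp}.
Implicit Types (x y : T) (C : {set T}).

Definition is_chain C : bool := [forall x in C, forall y in C, (x >=< y)%O].

Definition covers : rel T :=
  fun x y => (x < y)%O && ~~ [exists z, (x < z)%O && (z < y)%O].

Definition hasse_diagram : rel T := fun x y => covers x y || covers y x.

End FinitePoset.

Definition height {disp : Order.disp_t} (T : finPOrderType disp) : nat :=
  \max_(C : {set T} | is_chain C) #|C|.

(* A simple graph is given by its adjacency relation [e], symmetric and
   irreflexive.  For such [e], [ucycle e [:: x; y]] holds for every edge xy, so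
   graph cycles are the simple cyclic sequences with at least three vertices. *)
Definition is_tree (V : finType) (e : rel V) : Prop :=
  [/\ (0 < #|V|)%N,
      forall x y : V, connect e x y
    & forall c : seq V, ucycle e c -> (size c <= 2)%N].

Definition middle_layers (R : realType) (n : nat) : {set {set 'I_n}} :=
  [set v : {set 'I_n} |
    (n%:R / 2 - 2 * Num.sqrt (n%:R * ln n%:R) <= #|v|%:R :> R)%R &&
    (#|v|%:R <= n%:R / 2 + 2 * Num.sqrt (n%:R * ln n%:R) :> R)%R].

Definition contains_induced {disp : Order.disp_t} (n : nat)
    (F : {set {set 'I_n}}) (T : finPOrderType disp) : Prop :=
  exists f : T -> {set 'I_n},
    [/\ injective f,
        forall u, f u \in F
      & forall u v, (u <= v)%O <-> f u \subset f v].

(* Main.v *)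
(** A random full chain through a set [v] of the middle layers is very unlikely
    to clash with a bounded number of other sets [x] of the middle layers: going
    up from [v], it contains a given point outside [v] before leaving the middle
    layers with probability O(sqrt(ln n / n)), and its first new point lies in
    [x] with the same probability.

    Put [F] on each of the levels [1, ..., k], and repeatedly delete a token
    [(v, i)] such that, for some level [j <> i], less than a fraction [delta] of
    the chains through [v] meet level [j] on the appropriate side of [v].  A chain
    with [X] members of [F] has [X - k + 1] windows of [k] consecutive members.
    The deletion of [(v, i)] breaks at most one window of each chain, and only on
    chains through [v] that still met level [j]; so if every token were deleted,
    averaging over the chains would give [E X - (k - 1) <= k * delta * E X],
    contradicting [E X >= k - 1 + eps] for small [delta].  In the surviving system
    of levels, [H] is embedded one vertex at a time along the edges of its Hasse
    diagram, each new vertex being placed on the level given by its rank, on a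
    chain that creates no unwanted comparability with the at most [#|H|] sets
    already chosen. *)
Require Import Defs.
From HB Require Import structures.
From mathcomp Require Import all_boot all_order all_algebra all_fingroup.
From mathcomp Require Import reals exp.
From mathcomp Require Import zify ring lra.

Set Implicit Arguments.
Unset Strict Implicit.
Unset Printing Implicit Defensive.

Import Order.TTheory GRing.Theory Num.Theory.
Local Open Scope nat_scope.

(** * Full chains as permutations *)

Lemma leq_bin_half (n m : nat) : 'C(n, m) <= 'C(n, n./2).
Proof.
have up d : forall j, j + d = n./2 -> 'C(n, j) <= 'C(n, n./2).
  elim: d => [|d IH] j jd; first by rewrite -jd addn0.
  apply: leq_trans (IH j.+1 _); last by lia.
  have := mul_bin_left n j; nia.
have [le_m|lt_m] := leqP m n./2; first by apply: (up (n./2 - m)); lia.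
have [le_mn|lt_nm] := leqP m n; last by rewrite bin_small.
by rewrite -bin_sub //; apply: (up (n./2 - (n - m))); lia.
Qed.

(* A permutation [s] of ['I_n] encodes the full chain of its initial segments. *)
Definition initial (n : nat) (s : 'S_n) (m : nat) : {set 'I_n} :=
  s @: [set i : 'I_n | i < m].

Lemma mem_initial n (s : 'S_n) m (p : 'I_n) : (s p \in initial s m) = (p < m).
Proof. by rewrite mem_imset ?inE //; apply: perm_inj. Qed.

Lemma card_initial n (s : 'S_n) m : m <= n -> #|initial s m| = m.
Proof.
move=> le_mn; rewrite card_imset; last exact: perm_inj.
by rewrite -sum1dep_card -(big_ord_widen n (fun=> 1) le_mn) sum1_card card_ord.
Qed.

Lemma initial_sub n (s : 'S_n) m1 m2 :
  m1 <= m2 -> initial s m1 \subset initial s m2.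
Proof.
move=> le12; apply/imsetS/subsetP => i; rewrite !inE => lt_i.
exact: leq_trans lt_i le12.
Qed.

Definition on_chain (n : nat) (s : 'S_n) (v : {set 'I_n}) : bool :=
  initial s #|v| == v.

(** This is [|v|! (n - |v|)!] in view of [weight_bin]; divided by [n!] it is the probability that a
    uniform random full chain passes through [v]. *)
Definition weight (n : nat) (v : {set 'I_n}) : nat :=
  #|[set s : 'S_n | on_chain s v]|.

Lemma card_leq n (v : {set 'I_n}) : #|v| <= n.
Proof. by rewrite -[X in _ <= X](card_ord n) max_card. Qed.

Lemma on_chainP n (s : 'S_n) (v : {set 'I_n}) :
  reflect (forall p, (s p \in v) = (p < #|v|)) (on_chain s v).
Proof.
apply: (iffP eqP) => [<- p|sv].
  by rewrite mem_initial card_initial ?card_leq.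
by apply/setP => x; rewrite -(permKV s x) mem_initial sv.
Qed.

Lemma on_chain_initial n (s : 'S_n) m : m <= n -> on_chain s (initial s m).
Proof. by move=> le_mn; rewrite /on_chain card_initial. Qed.

Lemma on_chain_sub n (s : 'S_n) (u v : {set 'I_n}) :
  on_chain s u -> on_chain s v -> (u \subset v) = (#|u| <= #|v|).
Proof.
move=> su sv; apply/idP/idP => [|le_uv]; first exact: subset_leq_card.
by rewrite -(eqP su) -(eqP sv) initial_sub.
Qed.

Lemma on_chain_proper n (s : 'S_n) (u v : {set 'I_n}) :
  on_chain s u -> on_chain s v -> (u \proper v) = (#|u| < #|v|).
Proof.
by move=> su sv; rewrite properE !(on_chain_sub (s := s)) // -ltnNge; lia.
Qed.

(* Composing with a transposition shows that, among the chains through [v],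
   the element in position [p] is uniform on its side of [v]. *)
Lemma weight_position n (v : {set 'I_n}) (p t : 'I_n) :
  (t \in v) = (p < #|v|) ->
  weight v = #|[set x | (x \in v) == (t \in v)]|
             * #|[set s : 'S_n | on_chain s v & s p == t]|.
Proof.
move=> tv.
transitivity (\sum_(s : 'S_n | on_chain s v) 1); first by rewrite sum1dep_card.
rewrite (partition_big (fun s : 'S_n => s p)
  (fun x => (x \in v) == (t \in v))) /=; last first.
  by move=> s /on_chainP ->; rewrite tv.
rewrite -sum_nat_const [RHS](eq_bigl (fun x => (x \in v) == (t \in v))).
  apply: eq_bigr => x /eqP xt; rewrite sum1dep_card.
  rewrite -(card_imset _ (mulIg (tperm x t))); apply: eq_card => s.
  apply/imsetP/idP => [[s'] |].
    rewrite !inE => /andP[/on_chainP sv /eqP spx] ->.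
    rewrite permM spx tpermL eqxx andbT; apply/on_chainP => q.
    by rewrite permM -sv; case: tpermP => [->|->|//].
  rewrite inE => /andP[/on_chainP sv /eqP spt].
  exists (s * tperm x t)%g; last by rewrite -mulgA tperm2 mulg1.
  rewrite inE permM spt tpermR eqxx andbT; apply/on_chainP => q.
  by rewrite permM -sv; case: tpermP => [->|->|//].
by move=> x; rewrite inE.
Qed.

Lemma weight_up n (v : {set 'I_n}) (p t : 'I_n) :
  t \notin v -> #|v| <= p ->
  weight v = (n - #|v|) * #|[set s : 'S_n | on_chain s v & s p == t]|.
Proof.
move=> tv le_vp; rewrite (@weight_position _ v p t); last first.
  by rewrite (negPf tv) ltnNge le_vp.
have -> : n - #|v| = #|~: v| by have := cardsC v; rewrite card_ord; lia.
by congr (_ * _); apply: eq_card => x; rewrite !inE (negPf tv) eqbF_neg.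
Qed.

Lemma weight_down n (v : {set 'I_n}) (p t : 'I_n) :
  t \in v -> p < #|v| ->
  weight v = #|v| * #|[set s : 'S_n | on_chain s v & s p == t]|.
Proof.
move=> tv lt_pv; rewrite (@weight_position _ v p t); last by rewrite tv lt_pv.
by congr (_ * _); apply: eq_card => x; rewrite !inE tv eqb_id.
Qed.

(** Induction on [|v|]: the chains through both [v :\ t] and [v] are counted from either side by
    [weight_up] and [weight_down], which yields the binomial recursion. *)
Lemma weight_bin n (v : {set 'I_n}) : weight v * 'C(n, #|v|) = n`!.
Proof.
move sz: #|v| => m; elim: m v sz => [|m IH] v sz.
  rewrite bin0 muln1 -card_Sn /weight.
  apply: eq_card => s; rewrite !inE; apply/on_chainP => p.
  by rewrite (cards0_eq sz) inE cards0.
have [t tv] : exists t, t \in v by apply/card_gt0P; rewrite sz.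
have sz' : #|v :\ t| = m by have := cardsD1 t v; rewrite tv sz => -[].
have lt_mn : m < n by have := card_leq v; lia.
have := IH _ sz'; rewrite (@weight_up _ _ (Ordinal lt_mn) t) ?sz' //; last first.
  by rewrite !inE eqxx.
rewrite (@weight_down _ v (Ordinal lt_mn) t) ?sz // => <-.
rewrite mulnAC mul_bin_left [RHS]mulnAC; congr (_ * _).
apply: eq_card => s; rewrite !inE; apply: andb_id2r => /eqP spt.
have sE p : (s p == t) = (p == m :> nat).
  by rewrite -spt (inj_eq perm_inj).
apply/on_chainP/on_chainP => sv p.
  by have := sv p; rewrite !inE sE sz sz' => ->; lia.
have := sv p; rewrite !inE sE sz sz'.
case: (eqVneq (p : nat) m) => [pm _|] /=; last by lia.
by move: (sE p); rewrite pm eqxx => /eqP ->; rewrite tv ltnS leqnn.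
Qed.

Lemma weight_gt0 n (v : {set 'I_n}) : 0 < weight v.
Proof. by have := fact_gt0 n; rewrite -(weight_bin v) muln_gt0 => /andP[]. Qed.

(** * Clashes along a random chain *)

Lemma card_bigcup_leq (I T : finType) (P : pred I) (A : I -> {set T}) :
  #|\bigcup_(i | P i) A i| <= \sum_(i | P i) #|A i|.
Proof.
elim/big_rec2: _ => [|i m B _ le_m]; first by rewrite cards0.
by rewrite (leq_trans (leq_card_setU _ _)) // leq_add2l.
Qed.

(* For [u] beyond [v], a clash with [x] is a comparability of [u] with [x] other
   than the one implied by transitivity through [v]. *)
Definition clash_above (n : nat) (v x u : {set 'I_n}) : bool :=
  (x \subset u) && ~~ (x \subset v) || (u \subset x).

Definition clash_below (n : nat) (v x u : {set 'I_n}) : bool :=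
  (u \subset x) && ~~ (v \subset x) || (x \subset u).

Lemma clash_belowE n (v x u : {set 'I_n}) :
  clash_below v x u = clash_above (~: v) (~: x) (~: u).
Proof. by rewrite /clash_below /clash_above !setCS. Qed.

(* A random chain through [v] rarely contains a given point [t] of [x :\: v]
   by level [#|v| + d], and its first step past [v] rarely stays in [x]. *)
Lemma clash_above_leq n (F : {set {set 'I_n}}) (d : nat) (v x : {set 'I_n}) :
  {in F &, forall u u' : {set 'I_n}, #|u| <= #|u'| + d} -> v \in F -> x \in F ->
  (n - #|v|) * #|[set s : 'S_n | on_chain s v &
     [exists u in F, [&& on_chain s u, v \proper u & clash_above v x u]]]|
  <= 2 * d * weight v.
Proof.
move=> gap vF xF.
pose K (p t : 'I_n) := [set s : 'S_n | on_chain s v & s p == t].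
(* [U t] holds the chains that pick up [t] within [d] positions past [v], [V p] those whose point at
   position [p] lies in [x :\: v]. By [leU] and [leV] each is at most a fraction [d / (n - |v|)] of
   the chains through [v]. *)
pose U t := \bigcup_(p : 'I_n | #|v| <= p < #|v| + d) K p t.
pose V (p : 'I_n) := \bigcup_(t in x :\: v) K p t.
have KE (p t : 'I_n) : t \notin v -> #|v| <= p ->
  (n - #|v|) * #|K p t| = weight v by move=> tv vp; rewrite -(weight_up tv vp).
have leU t : t \notin v -> (n - #|v|) * #|U t| <= d * weight v.
  move=> tv; apply: leq_trans (leq_mul (leqnn _) (card_bigcup_leq _ _)) _.
  rewrite big_distrr /= (eq_bigr (fun=> weight v)); last first.
    by move=> p /andP[vp _]; apply: KE.
  rewrite sum_nat_const leq_mul2r; apply/orP; right.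
  have /subset_leq_card : [set p : 'I_n | #|v| <= p < #|v| + d]
      \subset [set p : 'I_n | p < #|v| + d] :\: [set p : 'I_n | p < #|v|].
    by apply/subsetP => p; rewrite !inE -leqNgt.
  rewrite cardsE => /leq_trans; apply.
  have [le_n|lt_n] := leqP (#|v| + d) n; last first.
    apply: leq_trans (_ : n - #|v| <= _); last by lia.
    apply: leq_trans (_ : #|~: [set p : 'I_n | p < #|v|]| <= _).
      by rewrite subset_leq_card // subsetDr.
    have := cardsC [set p : 'I_n | p < #|v|]; rewrite card_ord.
    have := card_initial 1 (card_leq v); rewrite card_imset; last exact: perm_inj.
    by move=> ->; lia.
  rewrite cardsDS; last by apply/subsetP => p; rewrite !inE; lia.
  have := card_initial 1 (card_leq v); rewrite card_imset; last exact: perm_inj.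
  have := card_initial 1 le_n; rewrite card_imset; last exact: perm_inj.
  by move=> -> ->; lia.
have leV (p : 'I_n) : #|v| <= p -> v \subset x ->
    (n - #|v|) * #|V p| <= d * weight v.
  move=> vp vx; apply: leq_trans (leq_mul (leqnn _) (card_bigcup_leq _ _)) _.
  rewrite big_distrr /= (eq_bigr (fun=> weight v)); last first.
    by move=> t; rewrite inE => /andP[tv _]; apply: KE.
  rewrite sum_nat_const leq_mul2r cardsDS //.
  by rewrite leq_subLR gap ?orbT.
have inU s u t : on_chain s v -> u \in F -> on_chain s u -> t \in u ->
    t \notin v -> s \in U t.
  move=> sv uF su; rewrite -[t](permKV s) (on_chainP _ _ su) (on_chainP _ _ sv).
  rewrite -leqNgt => pu vp; apply/bigcupP; exists ((s^-1)%g t).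
    by rewrite vp /=; apply: leq_trans pu (gap _ _ uF vF).
  by rewrite inE sv eqxx.
have inV s u (p : 'I_n) : p = #|v| :> nat -> on_chain s v -> on_chain s u ->
    v \proper u -> u \subset x -> s \in V p.
  move=> pv sv su; rewrite (on_chain_proper sv su) => lt_vu /subsetP ux.
  apply/bigcupP; exists (s p); last by rewrite inE sv eqxx.
  rewrite inE (on_chainP _ _ sv) -leqNgt pv leqnn /=.
  by apply: ux; rewrite (on_chainP _ _ su) pv.
set B := [set s | _ & _].
suff {KE} : exists2 A : {set 'S_n}, B \subset A &
    (n - #|v|) * #|A| <= 2 * d * weight v.
  by case=> A /subset_leq_card BA; apply/leq_trans/leq_mul.
have [vn|nv] := ltnP #|v| n; last first.
  exists setT; first exact: subsetT.
  by have -> : n - #|v| = 0 by lia.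
pose p := Ordinal vn.
(* If [x] lies inside [v], the first kind of clash cannot occur, so any [t] outside [v] serves. *)
have [t tP] : exists t, t \notin v /\ (t \in x \/ x \subset v).
  have [xv|/subsetPn[t tx tv]] := boolP (x \subset v); last first.
    by exists t; split=> //; left.
  have /card_gt0P[t] : 0 < #|~: v| by have := cardsC v; rewrite card_ord; lia.
  by rewrite inE => tv; exists t; split=> //; right.
have [tv tx] := tP.
(* [U t] catches the clashes with [x] inside [u]; [V p] catches those with [u] inside [x], which
   force [v \subset x]. *)
exists (U t :|: (if v \subset x then V p else set0)).
  apply/subsetP => s; rewrite !inE => /andP[sv /existsP[u]].
  case/and4P => uF su vu /orP[/andP[xu xv]|ux].
    case: tx => [tx|]; last by rewrite (negPf xv).
    by rewrite (inU s u t) // (subsetP xu).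
  rewrite (subset_trans (proper_sub vu) ux) orbC.
  by rewrite (@inV s u).
apply: leq_trans (leq_mul (leqnn _) (leq_card_setU _ _)) _.
rewrite mulnDr mul2n -addnn mulnDl leq_add ?leU //.
by case: ifP => [vx|_]; [apply: leV | rewrite cards0 muln0].
Qed.

(** Precomposing with the reversal of positions reads the chain from the top, so that its members
    become complements. *)
Lemma on_chainC n (s : 'S_n) (v : {set 'I_n}) :
  on_chain (perm (@rev_ord_inj n) * s)%g (~: v) = on_chain s v.
Proof.
have cv : #|~: v| = n - #|v|.
  by apply/eqP; rewrite -(eqn_add2l #|v|) cardsC card_ord subnKC ?card_leq.
apply/on_chainP/on_chainP => sv p.
  have := sv (rev_ord p); rewrite permM permE rev_ordK inE /=.
  move/(congr1 negb); rewrite negbK => ->.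
  by rewrite cv; have := ltn_ord p; move: #|v| => m; lia.
rewrite permM permE inE sv cv /=.
by have := ltn_ord p; lia.
Qed.

Lemma weightC n (v : {set 'I_n}) : weight (~: v) = weight v.
Proof.
rewrite /weight -[RHS](card_imset _ (mulgI (perm (@rev_ord_inj n)))).
apply: eq_card => s; rewrite inE.
apply/idP/imsetP => [sv|[s' + ->]]; last by rewrite inE on_chainC.
exists ((perm (@rev_ord_inj n))^-1 * s)%g; last by rewrite mulKVg.
by rewrite inE -on_chainC mulKVg.
Qed.

(** Complementation reverses inclusions and exchanges [|v|] with [n - |v|], reducing the bound to
    [clash_above_leq] for the complemented family. *)
Lemma clash_below_leq n (F : {set {set 'I_n}}) (d : nat) (v x : {set 'I_n}) :
  {in F &, forall u u' : {set 'I_n}, #|u| <= #|u'| + d} -> v \in F -> x \in F ->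
  #|v| * #|[set s : 'S_n | on_chain s v &
     [exists u in F, [&& on_chain s u, u \proper v & clash_below v x u]]]|
  <= 2 * d * weight v.
Proof.
move=> gap vF xF; pose F' := @setC _ @: F.
have cC (w : {set 'I_n}) : #|w| + #|~: w| = n by rewrite cardsC card_ord.
have gap' : {in F' &, forall u u' : {set 'I_n}, #|u| <= #|u'| + d}.
  move=> _ _ /imsetP[u uF ->] /imsetP[u' uF' ->].
  by have := gap _ _ uF' uF; have := cC u; have := cC u'; lia.
have := clash_above_leq gap' (imset_f _ vF) (imset_f _ xF).
have -> : n - #|~: v| = #|v| by have := cC v; lia.
rewrite weightC; apply: leq_trans; rewrite leq_mul2l; apply/orP; right.
rewrite -(card_imset _ (mulgI (perm (@rev_ord_inj n)))).
apply/subset_leq_card/subsetP => _ /imsetP[s + ->].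
rewrite !inE on_chainC => /andP[-> /existsP[u /and4P[uF su uv vxu]]].
apply/existsP; exists (~: u); rewrite imset_f //= on_chainC su -clash_belowE vxu.
by rewrite properE !setCS -properE uv.
Qed.

Definition beyond (n : nat) (up : bool) (v u : {set 'I_n}) : bool :=
  if up then v \proper u else u \proper v.

Definition clash (n : nat) (up : bool) (v x u : {set 'I_n}) : bool :=
  if up then clash_above v x u else clash_below v x u.

Definition hits (n : nat) (up : bool) (A : {set {set 'I_n}}) (v : {set 'I_n}) :
    {set 'S_n} :=
  [set s : 'S_n | on_chain s v & [exists u in A, on_chain s u && beyond up v u]].

(** Union bound: each [x] in [X] spoils at most a fraction [2 * d / N] of the chains through [v],
    hence [X] spoils less than [delta] in total, while at least [delta] of them hit [A]. Some
    hitting chain is therefore unspoilt. *)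
Lemma avoid_clash (R : realType) n (F A X : {set {set 'I_n}}) (d N : nat)
    (up : bool) (v : {set 'I_n}) (delta : R) :
  {in F &, forall u u' : {set 'I_n}, #|u| <= #|u'| + d} ->
  A \subset F -> X \subset F -> v \in F -> N <= #|v| -> N <= n - #|v| ->
  ((2 * d * #|X|)%:R < delta * N%:R)%R ->
  (delta * (weight v)%:R <= #|hits up A v|%:R)%R ->
  exists2 u, u \in A & beyond up v u /\ {in X, forall x, ~~ clash up v x u}.
Proof.
move=> gap AF XF vF Nv Nnv small robust.
pose B x := [set s : 'S_n | on_chain s v &
     [exists u in F, [&& on_chain s u, beyond up v u & clash up v x u]]].
have NB x : x \in X -> N * #|B x| <= 2 * d * weight v.
  move=> /(subsetP XF) xF; rewrite /B /beyond /clash; case: (up).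
    by apply: leq_trans (clash_above_leq gap vF xF); rewrite leq_mul2r Nnv orbT.
  by apply: leq_trans (clash_below_leq gap vF xF); rewrite leq_mul2r Nv orbT.
suff /subsetPn[s] : ~~ (hits up A v \subset \bigcup_(x in X) B x).
  rewrite inE => /andP[sv /existsP[u /and3P[uA su vu]]] sB.
  exists u => //; split=> // x xX; apply: contraNN sB => cxu.
  apply/bigcupP; exists x; rewrite // inE sv; apply/existsP; exists u.
  by rewrite (subsetP AF) // su vu cxu.
apply/negP => /subset_leq_card/leq_trans/(_ (card_bigcup_leq _ _)) le_hits.
have : N * #|hits up A v| <= #|X| * (2 * d * weight v).
  apply: leq_trans (leq_mul (leqnn _) le_hits) _.
  by rewrite big_distrr /= -sum_nat_const leq_sum.
rewrite -(ler_nat R) => le_N.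
have wpos : (0 < (weight v)%:R :> R)%R by rewrite ltr0n weight_gt0.
have Npos : (0 <= N%:R :> R)%R by [].
rewrite !natrM in le_N small.
have := ler_wpM2l Npos robust.
have : (2%:R * d%:R * #|X|%:R * (weight v)%:R < delta * N%:R * (weight v)%:R :> R)%R.
  by rewrite ltr_pM2r.
lra.
Qed.

(** * Windows of marked chains *)

Definition marks (n : nat) (F : {set {set 'I_n}}) (s : 'S_n) : seq nat :=
  [seq m <- iota 0 n.+1 | initial s m \in F].

Lemma sorted_marks n (F : {set {set 'I_n}}) s : sorted ltn (marks F s).
Proof. by rewrite sorted_filter ?iota_ltn_sorted //; apply: ltn_trans. Qed.

Lemma nth_marks n (F : {set {set 'I_n}}) s j : j < size (marks F s) ->
  nth 0 (marks F s) j <= n /\ initial s (nth 0 (marks F s) j) \in F.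
Proof.
by move=> /(mem_nth 0); rewrite mem_filter mem_iota ltnS => /and3P[-> _ ->].
Qed.

Lemma size_marks n (F : {set {set 'I_n}}) s :
  size (marks F s) = #|[set v in F | on_chain s v]|.
Proof.
rewrite -(size_map (initial s)).
have uniq_m : uniq (map (initial s) (marks F s)).
  rewrite map_inj_in_uniq ?filter_uniq ?iota_uniq // => x y.
  rewrite !mem_filter !mem_iota !ltnS => /andP[_ xn] /andP[_ yn] xy.
  by rewrite -(card_initial s xn) xy card_initial.
rewrite -(card_uniqP uniq_m); apply: eq_card => v; rewrite inE.
apply/mapP/andP => [[m] | [vF sv]].
  rewrite mem_filter mem_iota ltnS => /and3P[mF _ mn] ->.
  by rewrite mF on_chain_initial.
exists #|v|; last by rewrite (eqP sv).
by rewrite mem_filter (eqP sv) vF mem_iota ltnS card_leq.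
Qed.

Lemma sum_size_marks n (F : {set {set 'I_n}}) :
  \sum_(s : 'S_n) size (marks F s) = \sum_(v in F) weight v.
Proof.
transitivity (\sum_(s : 'S_n) \sum_(v in F) (on_chain s v : nat)).
  apply: eq_bigr => s _; rewrite size_marks -sum1_card -big_mkcondr.
  by apply: eq_bigl => v; rewrite inE.
rewrite exchange_big; apply: eq_bigr => v _.
by rewrite -big_mkcond sum1dep_card.
Qed.

(* The starting ranks of the windows of [k] consecutive marks whose [i]-th mark
   is on level [i] for every [i]; there are at most [n.+1] marks. *)
Definition windows (n k : nat) (F : {set {set 'I_n}})
    (B : {set {set 'I_n} * 'I_k}) (s : 'S_n) : {set 'I_n.+2} :=
  [set j : 'I_n.+2 | (j + k <= size (marks F s)) &&
     [forall i : 'I_k, (initial s (nth 0 (marks F s) (j + i)), i) \in B]].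

Definition layer (n k : nat) (B : {set {set 'I_n} * 'I_k}) (i : 'I_k) :
    {set {set 'I_n}} :=
  [set v | (v, i) \in B].

(** With all tokens present, every start rank leaving room for [k] marks gives a window. If there
    are fewer than [k] marks, the term [k.-1] alone suffices. *)
Lemma card_windows_full n k (F : {set {set 'I_n}}) s :
  size (marks F s) <= #|windows F (setX F [set: 'I_k]) s| + k.-1.
Proof.
have le_n : size (marks F s) <= n.+1.
  by rewrite size_filter -[X in _ <= X](size_iota 0) count_size.
have [lt_k|le_k] := ltnP (size (marks F s)) k; first by lia.
have le_sz : size (marks F s) - k.-1 <= n.+2 by lia.
rewrite addnC -leq_subLR.
have -> : size (marks F s) - k.-1
    = #|[set j : 'I_n.+2 | j < size (marks F s) - k.-1]|.
  by rewrite -sum1dep_card -(big_ord_widen n.+2 (fun=> 1) le_sz) sum1_card card_ord.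
apply/subset_leq_card/subsetP => j; rewrite !inE => lt_j.
have le_j : j + k <= size (marks F s) by lia.
rewrite le_j; apply/forallP => i; rewrite !inE andbT.
apply: (nth_marks _).2; have := ltn_ord i; lia.
Qed.

(* Deleting one token [(v, i)] destroys at most the window in which [v] has
   rank [i], and that window witnesses a hit of each other layer. *)
Lemma windows_remove n k (F : {set {set 'I_n}}) (B : {set {set 'I_n} * 'I_k})
    (v : {set 'I_n}) (i i' : 'I_k) s : i' != i ->
  #|windows F B s| <= #|windows F (B :\ (v, i)) s|
                      + (s \in hits (i < i') (layer B i') v).
Proof.
move=> ii'; set ms := marks F s.
(* These are the only windows that the deletion can destroy. *)
pose L := [set j in windows F B s | initial s (nth 0 ms (j + i)) == v].
have sub : windows F B s \subset windows F (B :\ (v, i)) s :|: L.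
  apply/subsetP => j jB; rewrite !inE; move: (jB).
  rewrite inE -/ms => /andP[-> /forallP jB'] /=.
  have -> : [forall i0 : 'I_k, (initial s (nth 0 ms (j + i0)), i0) \in B] by apply/forallP.
  have [_ | nv] := eqVneq (initial s (nth 0 ms (j + i))) v; first by rewrite orbT.
  rewrite orbF; apply/forallP => i0; rewrite !inE jB' andbT xpair_eqE negb_and.
  by case: (eqVneq i0 i) => [->|]; rewrite ?nv ?orbT.
apply: leq_trans (subset_leq_card sub) _.
apply: leq_trans (leq_card_setU _ _) _; rewrite leq_add2l.
have [->|[j jL]] := set_0Vmem L; first by rewrite cards0.
have lt_ms j0 (i0 : 'I_k) : j0 \in L -> j0 + i0 < size ms.
  by rewrite !inE -/ms => /andP[/andP[le_j _] _]; have := ltn_ord i0; lia.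
have -> : s \in hits (i < i') (layer B i') v.
  move: (jL); rewrite !inE -/ms => /andP[/andP[_ /forallP jB] /eqP jv].
  have sm (i0 : 'I_k) : on_chain s (initial s (nth 0 ms (j + i0))).
    by apply/on_chain_initial; case: (nth_marks (lt_ms _ i0 jL)).
  have cm (i0 : 'I_k) : #|initial s (nth 0 ms (j + i0))| = nth 0 ms (j + i0).
    by apply/card_initial; case: (nth_marks (lt_ms _ i0 jL)).
  have nth_lt (i1 i2 : 'I_k) : i1 < i2 -> nth 0 ms (j + i1) < nth 0 ms (j + i2).
    move=> lt12; apply: (sorted_ltn_nth ltn_trans 0 (sorted_marks F s));
      by rewrite ?inE ?lt_ms // ltn_add2l.
  rewrite -jv sm; apply/existsP; exists (initial s (nth 0 ms (j + i'))).
  rewrite !inE jB sm /beyond; case: ltngtP ii' => [lt_ii|lt_ii|/val_inj ->];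
    rewrite ?eqxx //= => _;
    by rewrite (on_chain_proper (sm _) (sm _)) !cm nth_lt.
(* Marks are distinct, so two windows with [v] as their [i]-th mark start at the same rank. *)
rewrite [nat_of_bool _]/= -(cards1 j) subset_leq_card //; apply/subsetP => j' jL'.
rewrite inE; apply/eqP/val_inj/eqP; rewrite /= -(eqn_add2r i).
have sz1 := lt_ms _ i jL; have sz2 := lt_ms _ i jL'.
rewrite -(nth_uniq 0 sz2 sz1) ?filter_uniq ?iota_uniq //.
rewrite -(card_initial s (nth_marks sz1).1) -(card_initial s (nth_marks sz2).1).
by move: jL jL'; rewrite !inE => /andP[_ /eqP ->] /andP[_ /eqP ->].
Qed.

(** * Embedding trees *)

(** Induction on the number of elements strictly between: if [x < y] is not a covering, an
    intermediate [z] splits it into two intervals, neither of which has [z] in its interior. *)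
Lemma connect_covers {disp : Order.disp_t} (H : finPOrderType disp) (x y : H) :
  (x <= y)%O -> connect (@covers disp H) x y.
Proof.
move sz: #|[set z : H | (x < z < y)%O]| => m.
elim/ltn_ind: m x y sz => m IH x y sz.
rewrite le_eqVlt => /orP[/eqP ->|lt_xy]; first exact: connect0.
have [cxy|] := boolP (covers x y); first exact: connect1.
rewrite /covers lt_xy negbK => /existsP[z /andP[xz zy]].
have smaller (a b : H) : (x <= a)%O -> (b <= y)%O -> (a == z) || (b == z) ->
    (#|[set z : H | (a < z < b)%O]| < m)%N.
  move=> xa yb abz; rewrite -sz; apply: proper_card; apply/properP; split.
    apply/subsetP => w; rewrite !inE => /andP[aw wb].
    by rewrite (le_lt_trans xa aw) (lt_le_trans wb yb).
  exists z; rewrite ?inE ?xz ?zy //.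
  by case/orP: abz => /eqP ->; rewrite ltxx ?andbF.
apply: (connect_trans (y := z)).
  by apply: (IH _ (smaller x z _ _ _)); rewrite ?eqxx ?orbT // ltW.
by apply: (IH _ (smaller z y _ _ _)); rewrite ?eqxx ?orbT // ltW.
Qed.


Lemma le_connect_covers {disp : Order.disp_t} (H : finPOrderType disp) (x y : H) :
  connect (@covers disp H) x y = (x <= y)%O.
Proof.
apply/idP/idP; last exact: connect_covers.
case/connectP => p + ->; elim: p x => [|z p IH] x //= /andP[/andP[lt_xz _] /IH].
exact/le_trans/ltW.
Qed.

Definition inside (V : finType) (e : rel V) (D : {set V}) : rel V :=
  [rel a b | [&& a \in D, b \in D & e a b]].

(* A simple path from [w] into [D], cut at its first vertex in [D] and closed up
   inside [D], would be a long cycle unless it starts with the edge to [v]. *)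
Lemma tree_connect_head (V : finType) (e c : rel V) (D : {set V}) (v w y : V) :
  is_tree e -> {in D &, forall x y, connect (inside e D) x y} ->
  v \in D -> w \notin D -> e v w -> subrel c e ->
  y \in D -> connect c w y -> c w v /\ connect c v y.
Proof.
move=> [_ _ e_acyc] D_conn vD wD evw ce yD /connectP[p0 p0P y_last].
move: y_last yD; case/shortenP: p0P => p wp Up _ -> yD.
have has_p : has [in D] p.
  apply/hasP; exists (last w p) => //.
  by have := mem_last w p; rewrite inE => /predU1P[wl|//]; rewrite -wl yD in wD.
case/split_find: has_p wp Up yD => z p1 p2 zD p1D.
rewrite cat_path last_cat last_rcons rcons_path -!cats1.
move=> /andP[/andP[wp1 p1z] zp2] Up _.
have /connectP[q0 q0P v_last] := D_conn _ _ zD vD.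
move: v_last; case/shortenP: q0P => q zq Uq _ v_last.
have [qD eq] : all [in D] q /\ path e z q.
  elim: q z zq {zD p1z zp2 Up Uq v_last} => [|a q IH] z //=.
  by rewrite /inside /= => /andP[/and3P[_ -> ->] /IH[-> ->]].
(* The cycle leaves [w], enters [D] at [z], and returns through [q] to [v], a neighbour of [w].
   Having at most two vertices, it forces [p1] and [q] to be empty and [z = v]. *)
have : ucycle e (w :: p1 ++ z :: q).
  apply/andP; split.
    rewrite /= rcons_cat cat_path (sub_path ce wp1) /= (ce _ _ p1z) rcons_path eq.
    by rewrite -v_last evw.
  move: Up; rewrite /= -catA /= mem_cat cat_uniq inE !negb_or.
  move=> /andP[/and3P[wp1' wz _] /and3P[Up1 _ _]].
  rewrite mem_cat negb_or wp1' inE negb_or wz cat_uniq Up1 Uq andbT /=.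
  rewrite (contra (allP qD w)) //= negb_or; apply/andP; split.
    by apply: contra p1D => zp1; apply/hasP; exists z.
  apply/hasPn => a aq; apply/negP => ap1; case/negP: p1D.
  by apply/hasP; exists a => //; apply: (allP qD).
move=> /e_acyc; rewrite /= size_cat /= addnS !ltnS leqn0 addn_eq0 !size_eq0.
move=> /andP[/eqP p1E /eqP qE]; rewrite v_last qE /=.
move: p1z; rewrite p1E /= => wz.
by split=> //; apply/connectP; exists p2.
Qed.

Lemma exists_boundary_edge (V : finType) (e : rel V) (D : {set V}) (x y : V) :
  x \in D -> y \notin D -> connect e x y ->
  exists v w, [/\ v \in D, w \notin D & e v w].
Proof.
move=> xD + /connectP[p + yE]; rewrite {y}yE.
elim: p x xD => [|z p IH] x xD /= => [|zD /andP[exz zp]]; first by rewrite xD.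
have [zD'|zD'] := boolP (z \in D); first exact: IH zD' zD zp.
by exists x, z.
Qed.

Lemma inside_setU1 (V : finType) (e : rel V) (D : {set V}) (v w : V) :
  symmetric e -> v \in D -> e v w ->
  {in D &, forall x y, connect (inside e D) x y} ->
  {in w |: D &, forall x y, connect (inside e (w |: D)) x y}.
Proof.
move=> e_sym vD evw D_conn.
have csym : connect_sym (inside e (w |: D)).
  by apply/sym_connect_sym => x y; rewrite /inside /= e_sym andbCA.
have to_v x : x \in w |: D -> connect (inside e (w |: D)) x v.
  rewrite in_setU1 => /predU1P[->|xD].
    by apply: connect1; rewrite /inside /= !inE eqxx vD orbT e_sym.
  apply: connect_sub (D_conn _ _ xD vD) => a b /and3P[aD bD eab].
  by apply: connect1; rewrite /inside /= !inE aD bD eab !orbT.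
move=> x y xD yD; apply: connect_trans (to_v _ xD) _.
by rewrite csym to_v.
Qed.

Lemma hasse_sym {disp : Order.disp_t} (H : finPOrderType disp) :
  symmetric (@hasse_diagram disp H).
Proof. by move=> x y; rewrite /hasse_diagram orbC. Qed.

(** The placed set [D] is kept connected. In a tree a new vertex [w] is then related to [D] only
    through its neighbour [v], so the absence of clashes makes all comparabilities of the new set
    correct. *)
Lemma tree_embedding {disp : Order.disp_t} (H : finPOrderType disp) (n k : nat)
    (F : {set {set 'I_n}}) (r : H -> 'I_k) (B : {set {set 'I_n} * 'I_k}) :
  is_tree (@hasse_diagram disp H) -> B != set0 -> B \subset setX F setT ->
  (forall x y, (x < y)%O -> r x < r y) ->
  (forall v (i j : 'I_k) (X : {set {set 'I_n}}),
     (v, i) \in B -> X \subset F -> #|X| <= #|H| -> j != i ->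
     exists2 u, u \in layer B j &
       beyond (i < j) v u /\ {in X, forall x, ~~ clash (i < j) v x u}) ->
  contains_induced F H.
Proof.
move=> H_tree B0 BF r_lt extend.
have layerF i : {subset layer B i <= F}.
  by move=> v; rewrite inE => /(subsetP BF); rewrite inE => /andP[].
have [H_gt0 H_conn _] := H_tree.
pose good (D : {set H}) (f : H -> {set 'I_n}) :=
  {in D, forall x, f x \in layer B (r x)} /\
  {in D &, forall x y, (x <= y)%O = (f x \subset f y)}.
have grow m : 0 < m <= #|H| -> exists D : {set H}, [/\ #|D| = m,
    {in D &, forall x y, connect (inside (@hasse_diagram disp H) D) x y}
    & exists f, good D f].
  elim: m => // -[|m] IH /andP[_ le_m].
    have /card_gt0P[x0 _] := H_gt0.
    (* Any token starts the embedding; if its level is wrong, one extension with nothing to avoid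
       reaches level [r x0]. *)
    have [u uB] : exists u, u \in layer B (r x0).
      have /set0Pn[[v i] viB] := B0.
      have [ri|ri] := eqVneq (r x0) i; first by exists v; rewrite ri inE.
      have [||u uB _] := extend v i (r x0) set0 viB _ _ ri;
        rewrite ?sub0set ?cards0 //.
      by exists u.
    exists [set x0]; rewrite cards1; split=> //.
      by move=> x y /set1P -> /set1P ->; apply: connect0.
    exists (fun=> u); split=> [x /set1P -> //|x y /set1P -> /set1P ->].
    by rewrite lexx subxx.
  have [|D [cD D_conn [f [fB f_le]]]] := IH; first by rewrite /= ltnW.
  have [x xD] : exists x, x \in D by apply/card_gt0P; rewrite cD.
  have [y yD] : exists y, y \notin D.
    have /card_gt0P[y] : 0 < #|~: D| by rewrite -(ltn_add2l #|D|) cardsC cD addn0.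
    by rewrite inE => yD; exists y.
  have [v [w [vD wD evw]]] := exists_boundary_edge xD yD (H_conn x y).
  have conn' := inside_setU1 (@hasse_sym _ H) vD evw D_conn.
  (* A path of coverings from [w] into [D] must begin with the edge to [v]; [below] is the same for
     the reversed covering relation. *)
  have above z : z \in D -> (w <= z)%O -> covers w v /\ (v <= z)%O.
    rewrite -!le_connect_covers; apply: (tree_connect_head H_tree D_conn vD wD evw).
    by move=> a b cab; rewrite /hasse_diagram cab.
  have below z : z \in D -> (z <= w)%O -> covers v w /\ (z <= v)%O.
    have crev (a b : H) : (a <= b)%O = connect (fun a b : H => covers b a) b a.
      by rewrite -le_connect_covers; have /= -> := connect_rev (@covers disp H) b a.
    rewrite !crev.
    apply: (tree_connect_head (c := fun a b : H => covers b a) H_tree D_conn vD wD evw).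
    by move=> a b cab; rewrite /hasse_diagram cab orbT.
  have fF z : z \in D -> f z \in F by move=> zD; apply/layerF/fB.
  have DH : #|f @: D| <= #|H| by rewrite (leq_trans (leq_imset_card _ _)) // cD ltnW.
  have DF : f @: D \subset F by apply/subsetP => _ /imsetP[z zD ->]; apply: fF.
  have vB : (f v, r v) \in B by have := fB v vD; rewrite inE.
  have [u uB uP] : exists2 u, u \in layer B (r w) & {in D, forall z,
      ((w <= z)%O = (u \subset f z)) /\ ((z <= w)%O = (f z \subset u))}.
    (* If [v < w], nothing in [D] lies above [w], and the members of [D] below [w] are those below
       [v]; a clash-free [u] above [f v] matches this. The other case is dual. *)
    case/orP: evw => [/andP[vw _]|/andP[wv _]].
      have rvw := r_lt _ _ vw.
      have ne : r w != r v by rewrite -val_eqE /= gtn_eqF.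
      have [u uB [+ uP]] := extend _ _ (r w) _ vB DF DH ne.
      rewrite rvw /beyond in uP * => vu; exists u => // z zD.
      have := uP (f z) (imset_f f zD).
      rewrite /clash /clash_above negb_or negb_and negbK.
      move=> /andP[zu /negPf ->]; split.
        apply/negP => /(above _ zD)[/andP[wv _] _].
        by have := lt_trans vw wv; rewrite ltxx.
      apply/idP/idP => [/(below _ zD)[_]|fzu].
        by rewrite f_le // => /subset_trans; apply; apply: proper_sub.
      by apply: le_trans (ltW vw); rewrite f_le //; rewrite fzu in zu.
    have rwv := r_lt _ _ wv.
    have ne : r w != r v by rewrite -val_eqE /= ltn_eqF.
    have [u uB [+ uP]] := extend _ _ (r w) _ vB DF DH ne.
    rewrite ltnNge (ltnW rwv) /beyond /= in uP * => vu; exists u => // z zD.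
    have := uP (f z) (imset_f f zD).
    rewrite /clash /clash_below negb_or negb_and negbK.
    move=> /andP[zu /negPf ->]; split; last first.
      apply/negP => /(below _ zD)[/andP[vw _] _].
        by have := lt_trans vw wv; rewrite ltxx.
    apply/idP/idP => [/(above _ zD)[_]|fzu].
      by rewrite f_le // => /(subset_trans _); apply; apply: proper_sub.
    by apply: le_trans (ltW wv) _; rewrite f_le //; rewrite fzu in zu.
  exists (w |: D); split=> //; first by rewrite cardsU1 wD cD.
  pose f' z := if z == w then u else f z.
  have f'w : f' w = u by rewrite /f' eqxx.
  have f'D z : z \in D -> f' z = f z.
    by move=> zD; rewrite /f'; case: eqP => // zw; rewrite zw (negPf wD) in zD.
  exists f'; split=> [z|z1 z2].
    by rewrite in_setU1 => /predU1P[->|zD]; [rewrite f'w | rewrite f'D // fB].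
  rewrite !in_setU1 => /predU1P[->|z1D] /predU1P[->|z2D]; rewrite ?f'w ?f'D //.
  - by rewrite lexx subxx.
  - exact: (uP _ z2D).1.
  - exact: (uP _ z1D).2.
  - exact: f_le.
have [|D [cD _ [f [fB f_le]]]] := grow #|H|; first by rewrite H_gt0 leqnn.
have DT x : x \in D.
  have /eqP -> : D == setT by rewrite eqEcard subsetT cardsT cD /=.
  exact: in_setT.
exists f; split=> [x y fxy|x|x y].
- by apply/le_anti; rewrite !f_le ?DT // fxy subxx.
- by apply/layerF/fB/DT.
- by rewrite f_le ?DT.
Qed.

(* [rank x] is one less than the size of a longest chain with top [x]. *)
Definition rank {disp : Order.disp_t} (H : finPOrderType disp) (x : H) : nat :=
  \max_(C : {set H} | is_chain C && [forall y in C, (y < x)%O]) #|C|.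

Lemma is_chain_setU1 {disp : Order.disp_t} (H : finPOrderType disp) (x : H) (C : {set H}) :
  is_chain C -> {in C, forall y, (y < x)%O} -> is_chain (x |: C).
Proof.
move=> /forall_inP chC ltC; apply/forall_inP => y yC; apply/forall_inP => z zC.
move: yC zC; rewrite !in_setU1 => /predU1P[->|yC] /predU1P[->|zC].
- exact: comparablexx.
- by rewrite comparable_sym; apply/lt_comparable/ltC.
- by apply/lt_comparable/ltC.
- exact: (forall_inP (chC _ yC)).
Qed.

Lemma rank_chain {disp : Order.disp_t} (H : finPOrderType disp) (x : H) :
  exists C : {set H}, [/\ is_chain C, {in C, forall y, (y < x)%O} & #|C| = rank x].
Proof.
have [|C /andP[chC /forall_inP ltC] rE] := @eq_bigmax_cond _
  [pred C : {set H} | is_chain C && [forall y in C, (y < x)%O]] (fun C => #|C|).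
  apply/card_gt0P; exists set0; rewrite inE; apply/andP; split.
    by apply/forall_inP => y; rewrite inE.
  by apply/forall_inP => y; rewrite inE.
by exists C; split=> //; rewrite /rank rE.
Qed.

(** Ranks can thus serve as levels in ['I_k]: adding [x] to a longest chain below it gives a chain
    of [H]. *)
Lemma rank_lt_height {disp : Order.disp_t} (H : finPOrderType disp) (x : H) :
  rank x < height H.
Proof.
have [C [chC ltC <-]] := rank_chain x.
have xC : x \notin C by apply/negP => /ltC; rewrite ltxx.
have := @leq_bigmax_cond _ _ (fun C : {set H} => #|C|) _ (is_chain_setU1 chC ltC).
by rewrite cardsU1 xC.
Qed.

Lemma rank_lt {disp : Order.disp_t} (H : finPOrderType disp) (x y : H) :
  (x < y)%O -> rank x < rank y.
Proof.
move=> xy; have [C [chC ltC <-]] := rank_chain x.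
have xC : x \notin C by apply/negP => /ltC; rewrite ltxx.
apply: (@leq_trans #|x |: C|); first by rewrite cardsU1 xC.
apply: (@leq_bigmax_cond _ _ (fun C : {set H} => #|C|)); rewrite is_chain_setU1 //; apply/forall_inP => z.
by rewrite in_setU1 => /predU1P[-> //|/ltC zx]; apply: lt_trans xy.
Qed.

(** * Robust systems of levels *)

Local Open Scope ring_scope.

Definition robust (R : realType) (n k : nat) (delta : R)
    (B : {set {set 'I_n} * 'I_k}) : bool :=
  [forall t in B, forall j : 'I_k, (j != t.2) ==>
     (delta * (weight t.1)%:R <= #|hits (t.2 < j)%N (layer B j) t.1|%:R)].

(** Induction on the number of tokens: since [B] is not robust, some token has a level hit by less
    than [delta] of its chains, and deleting it costs at most one window on each of these. The empty
    system has no windows, as [k > 0]. *)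
Lemma sum_windows_leq (R : realType) n k (delta : R) (F : {set {set 'I_n}})
    (B : {set {set 'I_n} * 'I_k}) : (0 < k)%N -> 0 <= delta ->
  (forall B' : {set {set 'I_n} * 'I_k}, B' \subset B -> robust delta B' -> B' = set0) ->
  (\sum_(s : 'S_n) #|windows F B s|)%:R <= delta * \sum_(t in B) (weight t.1)%:R.
Proof.
move=> k_gt0 delta_ge0; move sz: #|B| => m; elim: m B sz => [|m IH] B sz noR.
  rewrite (cards0_eq sz) big_set0 mulr0 big1 // => s _; apply: eq_card0 => j.
  by rewrite !inE; apply/negP => /andP[_ /forallP/(_ (Ordinal k_gt0))]; rewrite inE.
have /forall_inPn[[v i] viB /forallPn[j]] : ~~ robust delta B.
  by apply/negP => /(noR _ (subxx B)) B0; rewrite B0 cards0 in sz.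
rewrite negb_imply -ltNge /= => /andP[ji lt_hits].
have sz' : #|B :\ (v, i)| = m by have := cardsD1 (v, i) B; rewrite viB sz => -[].
have noR' (B' : {set {set 'I_n} * 'I_k}) : B' \subset B :\ (v, i) -> robust delta B' -> B' = set0.
  by move=> sB'; apply/noR/(subset_trans sB')/subsetDl.
have IHB := IH _ sz' noR'.
rewrite (big_setD1 (v, i)) //= mulrDr addrC.
apply: le_trans (lerD IHB (ltW lt_hits)); rewrite -natrD ler_nat.
have le_s s := windows_remove F B v s ji.
apply: leq_trans (leq_sum _ (fun s _ => le_s s)) _.
rewrite big_split leq_add2l /= -[X in (_ <= X)%N]sum1_card.
by rewrite [X in (_ <= X)%N]big_mkcond leq_sum // => s _; case: (s \in _).
Qed.

(** Otherwise [sum_windows_leq] applies to the full system, bounding its windows by [k * delta]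
    times the total weight, whereas [card_windows_full] gives at least the total weight minus
    [(k - 1) * n!]. *)
Lemma exists_robust (R : realType) n k (delta : R) (F : {set {set 'I_n}}) :
  (0 < k)%N -> 0 <= delta ->
  k%:R * delta * (\sum_(v in F) weight v)%:R + (k%:R - 1) * n`!%:R
    < (\sum_(v in F) weight v)%:R ->
  exists2 B : {set {set 'I_n} * 'I_k}, B != set0 & B \subset setX F setT /\ robust delta B.
Proof.
move=> k_gt0 delta_ge0 big_F.
have [/existsP[B /and3P[B0 sB rB]]|/existsPn noB] := boolP [exists B : {set {set 'I_n} * 'I_k},
  [&& B != set0, B \subset setX F setT & robust delta B]]; first by exists B.
have noR (B : {set {set 'I_n} * 'I_k}) : B \subset setX F setT -> robust delta B -> B = set0.
  by move=> sB rB; have := noB B; rewrite sB rB !andbT negbK => /eqP.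
have := sum_windows_leq F k_gt0 delta_ge0 noR.
have -> : \sum_(t in setX F [set: 'I_k]) (weight t.1)%:R
    = k%:R * (\sum_(v in F) weight v)%:R :> R.
  rewrite (eq_bigl (fun t => (t.1 \in F) && true)); last by move=> t; rewrite !inE.
  rewrite -(pair_big (mem F) predT (fun v _ => (weight v)%:R)) /=.
  rewrite natr_sum mulr_sumr; apply: eq_bigr => v _.
  by rewrite sumr_const card_ord mulr_natl.
have : (\sum_(s : 'S_n) size (marks F s) <=
    \sum_(s : 'S_n) #|windows F (setX F [set: 'I_k]) s| + k.-1 * n`!)%N.
  have -> : (k.-1 * n`!)%N = (\sum_(s : 'S_n) k.-1)%N.
    by rewrite sum_nat_const card_Sn mulnC.
  by rewrite -big_split leq_sum // => s _; apply: card_windows_full.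
rewrite sum_size_marks -(ler_nat R) natrD natrM -subn1 natrB //.
lra.
Qed.

(** * Estimates for the middle layers and choice of constants *)

Lemma sum_weight_ge n (F : {set {set 'I_n}}) :
  (#|F| * n`! <= (\sum_(v in F) weight v) * 'C(n, n./2))%N.
Proof.
rewrite -sum_nat_const big_distrl leq_sum // => v _.
by rewrite -(weight_bin v) leq_mul2l leq_bin_half orbT.
Qed.

(** Since [ln n] is twice [ln (sqrt n)], it is at most [2 * sqrt n], and [2 <= c ^ 2 * sqrt n] as
    soon as [n >= 4 / c ^ 4]. *)
Lemma sqrt_n_ln_n_small (R : realType) (c : R) : 0 < c ->
  exists n0 : nat, forall n : nat, (n0 <= n)%N ->
    Num.sqrt (n%:R * ln n%:R) <= c * n%:R.
Proof.
move=> c_gt0; exists (Num.truncn (4 / c ^+ 4)).+1 => n le_n.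
have n_gt0 : 0 < n%:R :> R by rewrite ltr0n; apply: leq_trans le_n.
have s_gt0 : 0 < Num.sqrt n%:R :> R by rewrite sqrtr_gt0.
have sE : Num.sqrt n%:R ^+ 2 = n%:R :> R by rewrite sqr_sqrtr ?ltW.
have c4_gt0 : 0 < c ^+ 4 by rewrite exprn_gt0.
have c2s : 2 <= c ^+ 2 * Num.sqrt n%:R.
  rewrite -(@ler_pXn2r _ 2) ?nnegrE ?mulr_ge0 ?sqr_ge0 ?(ltW s_gt0) ?(ltW c_gt0) //.
  rewrite exprMn sE -exprM mulrC -ler_pdivrMr //.
  have -> : 2 ^+ 2 = 4 :> R by ring.
  by apply: le_trans (ltW (truncnS_gt _)) _; rewrite ler_nat.
have ln_n : ln n%:R <= 2 * Num.sqrt n%:R :> R.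
  rewrite -{1}sE lnXn // mulr_natl lerMn2r /= ltW // ln_sublinear //.
have cn_ge0 : 0 <= c * n%:R by rewrite mulr_ge0 ?ltW.
rewrite -[leRHS](ger0_norm cn_ge0) -sqrtr_sqr ler_wsqrtr //.
rewrite exprMn expr2 [n%:R ^+ 2]expr2 mulrCA ler_pM2l //.
apply: le_trans ln_n _; rewrite -{2}sE expr2 mulrA ler_pM2r //.
Qed.

(** [d] bounds the width of the middle layers up to rounding; [N] bounds both sides of [v] at once
    because the layers are symmetric about [n / 2]. *)
Lemma middle_layersP (R : realType) (n d N : nat) (F : {set {set 'I_n}}) :
  F \subset middle_layers R n ->
  4 * Num.sqrt (n%:R * ln n%:R) < d.+1%:R :> R ->
  N%:R <= n%:R / 2 - 2 * Num.sqrt (n%:R * ln n%:R) :> R ->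
  {in F &, forall u v : {set 'I_n}, (#|u| <= #|v| + d)%N} /\
  {in F, forall v : {set 'I_n}, (N <= #|v|)%N /\ (N <= n - #|v|)%N}.
Proof.
move=> FR lt_d le_N; split=> [u v|v].
  move=> /(subsetP FR) + /(subsetP FR); rewrite !inE => /andP[_ ub] /andP[vb _].
  by rewrite -ltnS -addnS -(ltr_nat R) natrD; lra.
move=> /(subsetP FR); rewrite inE => /andP[lb ub].
rewrite leq_subRL ?card_leq // -!(ler_nat R) natrD.
by split; lra.
Qed.

Theorem theorem1p4 (R : realType) (disp : Order.disp_t)
    (H : finPOrderType disp) (k : nat) (eps : R)
    (H_tree : is_tree (@hasse_diagram disp H))
    (H_height : height H = k) (k_ge2 : (2 <= k)%N) (eps_gt0 : 0 < eps) :
  exists n0 : nat, forall n : nat, (0 < n)%N -> (n0 <= n)%N ->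
    forall F : {set {set 'I_n}}, F \subset middle_layers R n ->
      (k%:R - 1 + eps) * 'C(n, n./2)%:R <= #|F|%:R ->
      contains_induced F H.
Proof.
have k_gt0 : (0 < k)%N by apply: leq_trans k_ge2.
have k1 : 1 <= k%:R :> R by rewrite ler1n.
have ke_gt0 : 0 < k%:R - 1 + eps by lra.
(* Chosen so that the deletions use up exactly half of [eps], as [kdelta] records. *)
pose delta : R := eps / (2 * k%:R * (k%:R - 1 + eps)).
have k0 : 0 < k%:R :> R by lra.
have delta_gt0 : 0 < delta by rewrite divr_gt0 // !mulr_gt0.
have kdelta : k%:R * delta * (k%:R - 1 + eps) = eps / 2.
  by rewrite /delta; field; rewrite !gt_eqF.
clearbody delta.
have [h hE] : {h : R | h = #|H|%:R} by exists #|H|%:R.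
have h0 : 0 <= h by rewrite hE.
(* Chosen so that [q <= c * n] gives [q_small]: the term [8 * h * q] pays for the clashes with
   [#|H|] sets, and [2 * delta * q] for the distance of the lowest layer from [n / 2]. *)
pose c : R := delta / (4 * (8 * h + 2 * delta)).
have den_gt0 : 0 < 8 * h + 2 * delta by lra.
have c_gt0 : 0 < c by rewrite divr_gt0 // mulr_gt0.
have [n1 n1P] := sqrt_n_ln_n_small c_gt0.
exists (maxn n1 5) => n n_gt0; rewrite geq_max => /andP[/n1P + n_ge5] F FR F_big.
set q := Num.sqrt _ => le_q.
have q_ge0 : 0 <= q by apply: sqrtr_ge0.
have n5 : 5 <= n%:R :> R by rewrite (ler_nat R 5).
have q_small : q * (8 * h + 2 * delta) <= delta * n%:R / 4.
  rewrite -ler_pdivlMr //; apply: le_trans le_q _.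
  by rewrite /c le_eqVlt; apply/orP; left; apply/eqP; field; rewrite gt_eqF.
have dn5 : delta * 5 <= delta * n%:R by rewrite ler_pM2l.
have qh_ge0 : 0 <= q * h by rewrite mulr_ge0.
pose d := Num.truncn (4 * q); pose N := Num.truncn (n%:R / 2 - 2 * q).
have half_ge0 : 0 <= n%:R / 2 - 2 * q.
  have : 0 <= delta * (n%:R / 2 - 2 * q) by lra.
  by rewrite pmulr_rge0.
have lt_d : 4 * q < d.+1%:R by apply: truncnS_gt.
have /andP[le_N lt_N] : N%:R <= n%:R / 2 - 2 * q < N.+1%:R by apply: truncn_itv.
have /andP[le_d _] : d%:R <= 4 * q < d.+1%:R by apply: truncn_itv; rewrite mulr_ge0.
have [gap bound] := middle_layersP FR lt_d le_N.
clearbody d N.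
(* Rounding [N] down costs less than [delta], which is below [delta * n / 4] because [n >= 5]. *)
have small : 2 * d%:R * h < delta * N%:R.
  have : d%:R * h <= 4 * q * h by rewrite ler_wpM2r.
  have : delta * (n%:R / 2 - 2 * q) < delta * N.+1%:R by rewrite ltr_pM2l.
  rewrite -[N.+1%:R]natr1; lra.
have big_weight : (k%:R - 1 + eps) * n`!%:R <= (\sum_(v in F) weight v)%:R.
  have C_gt0 : 0 < 'C(n, n./2)%:R :> R.
    by rewrite ltr0n bin_gt0 leq_half_double leqW // -addnn leq_addr.
  rewrite -(ler_pM2r C_gt0); have := sum_weight_ge F; rewrite -(ler_nat R) !natrM.
  apply: le_trans; rewrite mulrAC ler_pM2r //.
  by rewrite ltr0n fact_gt0.
have [|B B0 [BF B_robust]] := @exists_robust R n k delta F k_gt0 (ltW delta_gt0).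
  have kd_lt1 : k%:R * delta < 1.
    by rewrite -(ltr_pM2r ke_gt0) kdelta mul1r; lra.
  have fact_pos : 0 < n`!%:R :> R by rewrite ltr0n fact_gt0.
  (* By [kdelta] the product is [(k - 1 + eps / 2) * n!], strictly above the required
     [(k - 1) * n!]. *)
  have : (1 - k%:R * delta) * ((k%:R - 1 + eps) * n`!%:R)
      <= (1 - k%:R * delta) * (\sum_(v in F) weight v)%:R.
    by rewrite ler_pM2l // subr_gt0.
  have -> : (1 - k%:R * delta) * ((k%:R - 1 + eps) * n`!%:R)
      = (k%:R - 1 + eps / 2) * n`!%:R.
    by rewrite mulrA mulrBl mul1r kdelta; congr (_ * _); field.
  have : 0 < eps * n`!%:R by rewrite mulr_gt0.
  lra.
have rk (x : H) : (rank x < k)%N by rewrite -H_height rank_lt_height.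
apply: (@tree_embedding _ H n k F (fun x => Ordinal (rk x)) B) => //.
  exact: rank_lt.
move=> v i j X viB XF le_X ji.
have vF : v \in F by have := subsetP BF _ viB; rewrite inE => /andP[].
have [Nv Nnv] := bound v vF.
have jF : layer B j \subset F.
  by apply/subsetP => u; rewrite inE => /(subsetP BF); rewrite inE => /andP[].
have rob := implyP (forallP (forall_inP B_robust _ viB) j) ji.
apply: (avoid_clash gap jF XF vF Nv Nnv _ rob).
apply: le_lt_trans small.
by rewrite hE -!natrM ler_nat leq_mul2l le_X orbT.
Qed.
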